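(* Let $m$ be a positive integer such that $m^2+4$ is square-free. If $h(m^2+4)=1$, then $m=1$ or $m$ is a prime number.
   Context: For a square-free integer $d>1$, $h(d)$ denotes the class number of the real quadratic field $\mathbb{Q}(\sqrt d)$. *)

(* Defs.v *)
From mathcomp Require Import all_boot all_order all_algebra all_field.
From mathcomp Require Import finmap boolp classical_sets functions cardinality.

Set Implicit Arguments.
Unset Strict Implicit.
Unset Printing Implicit Defensive.

Import GRing.Theory Num.Theory.

Local Open Scope classical_set_scope.
Local Open Scope ring_scope.

Definition squarefree (n : nat) : Prop :=
  forall k : nat, (k ^ 2 %| n)%N -> k = 1%N.

(* Number fields are represented as subsets of algC. *)

Definition quadratic_field (d : nat) : set algC :=
  [set x | exists a b : rat, x = ratr a + ratr b * sqrtC d%:R].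

Definition ring_of_integers (K : set algC) : set algC :=
  [set x | K x /\ x \in Aint].

Record fractional_ideal (K I : set algC) : Prop := FractionalIdeal {
  fractional_ideal_sub : I `<=` K;
  fractional_ideal_neq0 : exists2 x, I x & x != 0;
  fractional_idealD : forall x y, I x -> I y -> I (x + y);
  fractional_idealM : forall c x, ring_of_integers K c -> I x -> I (c * x);
  fractional_ideal_denom : exists2 c, ring_of_integers K c & c != 0 /\
    forall x, I x -> ring_of_integers K (c * x)
}.

(* The principal fractional ideals are the (a) with a in K^*, and (a) I = a I,
   so this is the coset of I modulo the subgroup of principal ideals. *)
Definition ideal_class (K I : set algC) : set (set algC) :=
  [set [set a * x | x in I] | a in [set a | K a /\ a != 0]].

Definition class_group (K : set algC) : set (set (set algC)) :=
  [set ideal_class K I | I in fractional_ideal K].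

(* fset_set sends an infinite set to fset0, so this would be 0 if the class
   group were infinite. *)
Definition class_number (K : set algC) : nat :=
  #|` fset_set (class_group K)|.

Definition real_quadratic_class_number (d : nat) : nat :=
  class_number (quadratic_field d).

(* Main.v *)
Require Import Defs.
From mathcomp Require Import all_boot all_order all_algebra all_field.
From mathcomp Require Import finmap boolp classical_sets functions cardinality.
From mathcomp Require Import ring lra zify.

(** Put [eps = (m + sqrt (m^2 + 4)) / 2], a unit with [eps^2 = m eps + 1]; the
    ring of integers is [Z[eps]], with norm form [x^2 + m x y - y^2].
    Multiplying by powers of [eps] shows that a norm smaller than [m] in
    absolute value is a square up to sign.  On the other hand [eps - 1] has
    norm [-m], so for a prime [p] dividing [m] the lattice
    [Z p + Z (eps - 1)] is an ideal of norm [p]; class number one makes it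
    principal, and its generator has norm [p] or [-p].  As [p] is not a
    square, [p = m]. *)

Set Implicit Arguments.
Unset Strict Implicit.
Unset Printing Implicit Defensive.

Import GRing.Theory Num.Theory Order.TTheory.
Local Open Scope classical_set_scope.
Local Open Scope ring_scope.

(** * Values of the norm form *)

(* The norm of [x + y eps]. *)
Definition nform (m x y : int) : int := x ^+ 2 + m * x * y - y ^+ 2.

(** Descent on [|y|]: multiplication by [eps^-1] or [eps] turns the second coordinate into [x] or
    [x + m * y]. If neither is shorter than [y != 0], the norm is at least [m] in absolute value; at
    [y = 0] the norm is [x ^+ 2]. *)
Lemma nform_lt_sqr (m x y : int) :
  `|nform m x y| < m -> exists k : int, `|nform m x y| = k ^+ 2.
Proof.
have [n] := ubnP `|y|%N; elim: n x y => // n IH x y lt_yn lt_m.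
have [->|y_neq0] := eqVneq y 0.
  have -> : nform m x 0 = x ^+ 2 by rewrite /nform; ring.
  by exists x; rewrite ger0_norm ?sqr_ge0.
(* Both steps of the descent, by [eps^-1] and by [eps], negate the norm. *)
have [lt_xy|le_yx] := ltnP `|x|%N `|y|%N.
  have E : `|nform m (y - m * x) x| = `|nform m x y|.
    by rewrite -normrN /nform; congr `|_|; ring.
  by rewrite -E; apply: IH; [lia | rewrite E].
have [lt_xy'|le_yx'] := ltnP `|(x + m * y)%R|%N `|y|%N.
  have E : `|nform m y (x + m * y)| = `|nform m x y|.
    by rewrite -normrN /nform; congr `|_|; ring.
  by rewrite -E; apply: IH; [lia | rewrite E].
have m_gt0 : 0 < m := le_lt_trans (normr_ge0 _) lt_m.
exfalso; move: lt_m; rewrite /nform; apply/negP; rewrite -leNgt ler_normr.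
wlog y_gt0 : x y y_neq0 le_yx le_yx' {lt_yn} / 0 < y.
  move=> W; case: (ltP 0 y) => [|y_le0]; first exact: W.
  have -> : x ^+ 2 + m * x * y - y ^+ 2 =
    (- x) ^+ 2 + m * (- x) * (- y) - (- y) ^+ 2 by ring.
  by apply: W; lia.
have {}le_yx : y <= x \/ x <= - y by lia.
have {}le_yx' : y <= x + m * y \/ x + m * y <= - y by lia.
clear IH.
have le_m : m <= m * y ^+ 2 by nia.
(* In each of the three cases the norm, with the sign selected by [left] or [right], is at least
   [m * y ^+ 2]. *)
apply/orP; case: le_yx => [le_yx|le_xNy]; first left.
  have : 0 <= m * y * (x - y) by apply: mulr_ge0; [apply: mulr_ge0|]; lia.
  have : 0 <= (x - y) * (x + y) by apply: mulr_ge0; lia.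
  lia.
case: le_yx' => [le1|le2]; [right | left].
  have : 0 <= (- x - y) * (x + m * y - y) by apply: mulr_ge0; lia.
  lia.
have : 0 <= (- x - y) * (- x - m * y - y) by apply: mulr_ge0; lia.
have : 0 <= y * (- x - m * y - y) by apply: mulr_ge0; lia.
lia.
Qed.

(* [(x, y)] are the coordinates of a generator of [Z p + Z (eps - 1)]; the
   equations say that it divides [p] and [eps - 1] in [Z[eps]]. *)
Lemma nform_prime (p : nat) (m x y b c b' c' : int) :
  prime p -> (p %| m)%Z -> (p %| x + y)%Z ->
  x * b + y * c = p -> x * c + y * b + m * y * c = 0 ->
  x * b' + y * c' = -1 -> `|nform m x y| = p.
Proof.
move=> p_prime /dvdzP[q Em] /dvdzP[u Exy] E1 E2 E3.
have p_gt1 := prime_gt1 p_prime.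
have not_p1 (r : int) : r * p != 1.
  apply/eqP => Er; have := dvdz_mull r (dvdzz p); rewrite Er dvdzE dvdn1; lia.
(* Multiplicativity of the norm, applied to [(x + y eps) (b + c eps) = p]. *)
have NM : nform m x y * nform m b c = p%:Z ^+ 2.
  transitivity (nform m (x * b + y * c) (x * c + y * b + m * y * c)).
    by rewrite /nform; ring.
  by rewrite E1 E2 /nform; ring.
have : (`|nform m x y| %| p ^ 2)%N.
  by rewrite -[p]absz_nat -abszX -NM abszM dvdn_mulr.
case/(dvdn_pfactor _ _ p_prime) => -[|[|[|i]]] // _ EN.
(* Norm [1] is excluded: [p] divides [m] and [x + y], hence the norm. *)
- have Ex : x = u * p - y by rewrite -Exy; ring.
  have EN' : nform m x y = (u * (x - y) + q * x * y) * p.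
    by rewrite /nform Em; transitivity ((x + y) * (x - y) + q * p * x * y);
      [ring | rewrite Exy; ring].
  have : (p %| `|nform m x y|)%N by rewrite EN' abszM dvdn_mull.
  by rewrite EN dvdn1; lia.
- by rewrite -abszE EN expn1.
- exfalso.
  have EM : `|nform m b c|%N = 1%N.
    have /(congr1 absz) := NM; rewrite abszM EN abszX absz_nat => EM.
    have p2_gt0 : (0 < p ^ 2)%N by rewrite expn_gt0; lia.
    by apply/eqP; rewrite -(eqn_pmul2l p2_gt0) EM muln1.
  (* The conjugate of [b + c eps] is [(b + m * c) - c eps]. Multiplying by it shows that [p] divides
     [x] and [y] up to sign, against [E3]. *)
  have Ex : x * nform m b c = (b + m * c) * p.
    by rewrite -E1 -[RHS]subr0 -(mulr0 c) -[X in _ - c * X]E2 /nform; ring.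
  have Ey : y * nform m b c = - c * p.
    by rewrite -E1 -[RHS]add0r -(mulr0 b) -[X in b * X + _]E2 /nform; ring.
  have E4 : - nform m b c = (b' * (b + m * c) - c' * c) * p.
    transitivity (x * nform m b c * b' + y * nform m b c * c').
      by rewrite -mulN1r -E3; ring.
    by rewrite Ex Ey; ring.
  have [E|E] : nform m b c = 1 \/ nform m b c = -1 by lia.
    by have /eqP := not_p1 (- (b' * (b + m * c) - c' * c)); apply; rewrite mulNr -E4 E.
  by have /eqP := not_p1 (b' * (b + m * c) - c' * c); apply; rewrite -E4 E.
Qed.

(** * Integrality and irrationality in quadratic fields *)

(** Modulo 4 the equation reads [t ^+ 2 = (u * m) ^+ 2], so [t] and [u * m] have the same parity. *)
Lemma parity_norm (m t u n : int) : (m %% 2)%Z = 1 ->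
  t ^+ 2 - (m ^+ 2 + 4) * u ^+ 2 = 4 * n -> exists k, t = u * m + 2 * k.
Proof.
move=> m_odd E.
have [m' Em] : exists m', m = 2 * m' + 1 by exists (m %/ 2)%Z; lia.
have [i [t' [Et i01]]] : exists i t', t = 2 * t' + i /\ (i = 0 \/ i = 1).
  by exists (t %% 2)%Z, (t %/ 2)%Z; lia.
have [j [u' [Eu j01]]] : exists j u', u = 2 * u' + j /\ (j = 0 \/ j = 1).
  by exists (u %% 2)%Z, (u %/ 2)%Z; lia.
subst t u m; case: i01 j01 E => -> [] -> E.
- by exists (t' - u' * (2 * m' + 1)); ring.
- by lia.
- by lia.
- by exists (t' - u' * (2 * m' + 1) - m'); ring.
Qed.

(** The minimal polynomial of [x] has integer coefficients and divides ['X^2 - t *: 'X + n%:P]: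
    either it is linear and [x] is a rational algebraic integer, or the two polynomials coincide. *)
Lemma Aint_quadratic (x : algC) (t n : rat) :
  x \in Aint -> x ^+ 2 - ratr t * x + ratr n = 0 ->
  x \is a Num.int \/ t \is a Num.int /\ n \is a Num.int.
Proof.
move=> Ax qx0; pose q : {poly rat} := 'X^2 - t *: 'X + n%:P.
have [p [px p_monic p_dvd]] := minCpolyP x.
have size_q : size q = 3.
  rewrite /q -addrA size_polyDl size_polyXn // (leq_ltn_trans (size_polyD _ _)) //.
  rewrite size_polyN ltnS geq_max (leq_trans (size_scale_leq _ _)) ?size_polyX //.
  by rewrite (leq_trans (size_polyC_leq1 _)).
have q_monic : q \is monic.
  by rewrite monicE /lead_coef size_q /q !coefE /= mulr0 subr0 addr0.
have p_dvd_q : p %| q.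
  rewrite -p_dvd rootE /q rmorphD rmorphB /= map_polyXn map_polyZ map_polyX.
  by rewrite map_polyC !hornerE qx0.
have Zp : p \is a polyOver Num.int.
  apply/polyOverP => i; have /polyOverP/(_ i) : minCpoly x \is a polyOver Num.int by [].
  by rewrite px coef_map Cint_rat.
have [size_p|] := eqVneq (size p) 2.
  left; apply: Cint_rat_Aint => //.
  have := root_minCpoly x; rewrite px rootE horner_coef size_map_poly size_p.
  rewrite !big_ord_recr big_ord0 /= !coef_map /= add0r expr0 mulr1 expr1.
  have -> : p`_1 = 1 by move: p_monic; rewrite monicE /lead_coef size_p => /eqP.
  rewrite rmorph1 mul1r addrC addr_eq0 => /eqP ->.
  by rewrite -rmorphN Crat_rat.
move=> size_p; right.
have le_p := dvdp_leq (monic_neq0 q_monic) p_dvd_q.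
have lt_p : (1 < size p)%N by have := size_minCpoly x; rewrite px size_map_poly.
have {size_p}size_p : size p = size q by apply/eqP; rewrite eqn_leq le_p size_q; lia.
have Epq : p = q by apply/eqP; rewrite -eqp_monic // -dvdp_size_eqp // size_p.
move: Zp; rewrite Epq => /polyOverP Zq; split.
  by have := Zq 1%N; rewrite /q !coefE /= mulr1 addr0 add0r rpredN.
by have := Zq 0%N; rewrite /q !coefE /= mulr0 subr0 add0r.
Qed.

(** In lowest terms, the square of the denominator of [r] is coprime to the numerator and so divides
    [d]. *)
Lemma int_sqr_squarefree (d : nat) (r : rat) :
  squarefree d -> d%:R * r ^+ 2 \is a Num.int -> r \is a Num.int.
Proof.
move=> sqf /intrP[k]; case: (ratP r) => a b cop E.
have {}E : (d%:Z * a ^+ 2 = k * b.+1%:Z ^+ 2)%R.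
  apply: (@intr_inj rat); rewrite rmorphM rmorphXn [RHS]rmorphM [in RHS]rmorphXn /= -E.
  by field; rewrite nat1r pnatr_eq0.
have : (b.+1 ^ 2 %| d * `|a| ^ 2)%N.
  by rewrite -[d]absz_nat -abszX -abszM E abszM abszX dvdn_mull.
rewrite Gauss_dvdl; last by rewrite coprimeXl // coprimeXr // coprime_sym.
by move=> /sqf ->; rewrite divr1 intr_int.
Qed.

Lemma sqrtC_squarefree_irr (d : nat) :
  (1 < d)%N -> squarefree d -> sqrtC d%:R \notin Crat.
Proof.
move=> d_gt1 sqf; apply/negP => /CratP[r Er].
have {}Er : r ^+ 2 = d%:R.
  by apply: (fmorph_inj (ratr : rat -> algC)); rewrite rmorphXn /= -Er sqrtCK ratr_nat.
have d_neq0 : d%:R != 0 :> rat by rewrite pnatr_eq0; lia.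
(* Dividing by [d] yields an integer [k] with [d * k ^+ 2 = 1], which contradicts [1 < d]. *)
have E : d%:R * (r / d%:R) ^+ 2 = 1 by rewrite exprMn Er; field.
have /intrP[k Ek] : r / d%:R \is a Num.int.
  by apply: (int_sqr_squarefree sqf); rewrite E rpred1.
have : d%:Z * k ^+ 2 = 1.
  by apply: (@intr_inj rat); rewrite rmorphM rmorphXn /= -Ek -[RHS]E.
move=> /(congr1 absz); rewrite abszM absz_nat => /eqP; rewrite muln_eq1 => /andP[/eqP].
lia.
Qed.

(** * Class number one and principal ideals *)

(** The ring of integers is itself a fractional ideal, so [I] lies in its class. *)
Lemma class_number1_principal (K I : set algC) :
  class_number K = 1%N -> K 1 -> (forall x y, K x -> K y -> K (x * y)) ->
  (forall x y, K x -> K y -> K (x + y)) ->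
  fractional_ideal K I ->
  exists2 a, K a & I = [set a * x | x in ring_of_integers K].
Proof.
move=> h1 K1 KM KD fI.
have fO : fractional_ideal K (ring_of_integers K).
  split.
  - by move=> x [].
  - by exists 1; [split; rewrite ?rpred1 | exact: oner_neq0].
  - by move=> x y [Kx Ax] [Ky Ay]; split; [exact: KD | exact: rpredD].
  - by move=> x y [Kx Ax] [Ky Ay]; split; [exact: KM | exact: rpredM].
  - exists 1; first by split; rewrite ?rpred1.
    by split; [exact: oner_neq0 | move=> x; rewrite mul1r].
have class_eq : ideal_class K I = ideal_class K (ring_of_integers K).
  move: h1; rewrite /class_number.
  (* An infinite class group would get the default cardinality [0], not [1]. *)
  have [fin|inf] := pselect (finite_set (class_group K)); last first.
    by rewrite /fset_set; case: pselect => // _; rewrite cardfs0.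
  move=> /eqP/cardfs1P[c Ec].
  have in_c J : fractional_ideal K J -> ideal_class K J = c.
    move=> fJ; have : [set` fset_set (class_group K)] (ideal_class K J).
      by rewrite fset_setK //; exists J.
    by rewrite Ec /= inE => /eqP.
  by rewrite !in_c.
have : ideal_class K I I.
  exists 1; first by split=> //; exact: oner_neq0.
  by apply/seteqP; split=> [x [y Iy <-]|x Ix]; [rewrite mul1r | exists x; rewrite ?mul1r].
by rewrite class_eq => -[a [Ka _] <-]; exists a.
Qed.

(** * The unit [eps] and the ring of integers [Z[eps]] *)

Definition eps (m : nat) : algC := (m%:R + sqrtC (m ^ 2 + 4)%:R) / 2.

Lemma sqrtC_eps m : sqrtC (m ^ 2 + 4)%:R = 2 * eps m - m%:R.
Proof. by rewrite /eps; field. Qed.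

Lemma eps_sqr m : eps m ^+ 2 = m%:R * eps m + 1.
Proof.
have := sqrtCK ((m ^ 2 + 4)%:R : algC); rewrite sqrtC_eps natrD natrX => E; apply: (@mulfI _ 4); first by rewrite pnatr_eq0.
have -> : 4 * eps m ^+ 2 = (2 * eps m - m%:R) ^+ 2 + 4 * m%:R * eps m - m%:R ^+ 2 by ring.
by rewrite E; ring.
Qed.

Lemma eps_mul m (a b c d : algC) :
  (a + b * eps m) * (c + d * eps m) =
  a * c + b * d + (a * d + b * c + m%:R * b * d) * eps m.
Proof.
have -> : (a + b * eps m) * (c + d * eps m) =
  a * c + (a * d + b * c) * eps m + b * d * eps m ^+ 2 by ring.
by rewrite eps_sqr; ring.
Qed.

Lemma quadratic_fieldP m (x : algC) : quadratic_field (m ^ 2 + 4) x <->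
  exists a b : rat, x = ratr a + ratr b * eps m.
Proof.
rewrite /quadratic_field /= sqrtC_eps; split=> -[a [b ->]].
  exists (a - b * m%:R), (b * 2).
  by rewrite rmorphB !rmorphM /= !ratr_nat; ring.
exists (a + b * m%:R / 2), (b / 2).
by rewrite rmorphD !fmorph_div rmorphM /= !ratr_nat; field.
Qed.

Lemma Aint_eps m : eps m \in Aint.
Proof.
pose P : {poly algC} := 'X^2 - (m%:R *: 'X + 1).
apply: (@root_monic_Aint P).
- rewrite rootE /P; have := eps_sqr m; move: (eps m) => e.
  by rewrite !hornerE => ->; rewrite subrr.
- rewrite monicE /P lead_coefDl ?lead_coefXn // size_polyN size_polyXn.
  rewrite (leq_ltn_trans (size_polyD _ _)) // ltnS geq_max size_poly1 andbT.
  by rewrite (leq_trans (size_scale_leq _ _)) ?size_polyX.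
- apply/polyOverP => i; rewrite /P !coefE.
  by rewrite !(rpredB, rpredD, rpredM) ?rpred_nat.
Qed.

(** If [b != d], then [eps m], and with it the square root, would be rational. *)
Lemma eps_inj m (a b c d : int) :
  (0 < m)%N -> squarefree (m ^ 2 + 4) ->
  a%:~R + b%:~R * eps m = c%:~R + d%:~R * eps m -> a = c /\ b = d.
Proof.
move=> m_gt0 sqf E.
have Ebd : b = d.
  have [//|neq_bd] := eqVneq b d.
  have bd_neq0 : (b - d)%:~R != 0 :> algC by rewrite intr_eq0 subr_eq0.
  have d_gt1 : (1 < m ^ 2 + 4)%N by lia.
  case/negP: (sqrtC_squarefree_irr d_gt1 sqf); rewrite sqrtC_eps.
  have -> : eps m = (c - a)%:~R / (b - d)%:~R.
    apply: (mulIf bd_neq0); rewrite divfK // !rmorphB /=.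
    have -> : c%:~R - a%:~R = (b%:~R - d%:~R) * eps m.
      by rewrite mulrBl; apply/eqP; rewrite subr_eq addrAC eq_sym subr_eq -E addrC.
    by rewrite mulrC.
  by rewrite rpredB ?rpredM ?rpredV ?rpred_int ?rpred_nat.
by split=> //; move: E; rewrite Ebd => /addIr/intr_inj.
Qed.

Lemma ring_of_integersP m (x : algC) :
  odd m -> squarefree (m ^ 2 + 4) ->
  ring_of_integers (quadratic_field (m ^ 2 + 4)) x <->
  exists a b : int, x = a%:~R + b%:~R * eps m.
Proof.
move=> m_odd sqf; split=> [[[a [b Ex]] Ax]|[a [b ->]]]; last first.
  split; last first.
    by apply: rpredD; [|apply: rpredM; last exact: Aint_eps]; exact/Aint_Cint/rpred_int.
  by apply/quadratic_fieldP; exists a%:~R, b%:~R; rewrite !ratr_int.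
set d := (m ^ 2 + 4)%N in Ex.
(* The coefficients are the trace and norm of [x]. *)
have root_x : x ^+ 2 - ratr (2 * a) * x + ratr (a ^+ 2 - d%:R * b ^+ 2) = 0.
  rewrite Ex rmorphB !rmorphM /= !ratr_nat.
  transitivity (ratr b ^+ 2 * (sqrtC d%:R ^+ 2 - d%:R) : algC); first by ring.
  by rewrite sqrtCK subrr mulr0.
have [/intrP[k ->]|[/intrP[t Et] /intrP[n En]]] := Aint_quadratic Ax root_x.
  by exists k, 0; rewrite mul0r addr0.
have Edb : d%:R * (2 * b) ^+ 2 = (t ^+ 2 - 4 * n)%:~R.
  by rewrite rmorphB !rmorphM /= -Et -En; ring.
have /intrP[u Eu] : 2 * b \is a Num.int.
  by apply: (int_sqr_squarefree sqf); rewrite Edb rpred_int.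
have [k Ek] : exists k, t = u * m + 2 * k.
  apply: (@parity_norm m t u n); first by lia.
  apply: (@intr_inj rat); rewrite rmorphB !rmorphM rmorphD rmorphM /= -Et -Eu -En.
  by rewrite /d natrD natrX; ring.
(* As [sqrt d = 2 eps - m], the coordinates of [x] are [(t - u * m) / 2 = k] and [u]. *)
exists k, u; rewrite Ex sqrtC_eps.
have -> : a = (u * m + 2 * k)%:~R / 2 by rewrite -Ek -Et; field.
have -> : b = u%:~R / 2 by rewrite -Eu; field.
by rewrite !fmorph_div /= !ratr_int ratr_nat rmorphD !rmorphM /=; field.
Qed.

(** * The ideal of norm [p] and the conclusion *)

Lemma exists_norm_prime (m p : nat) :
  odd m -> squarefree (m ^ 2 + 4) -> real_quadratic_class_number (m ^ 2 + 4) = 1%N ->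
  prime p -> (p %| m)%N -> exists x y : int, `|nform m x y| = p.
Proof.
move=> m_odd sqf h1 p_prime p_dvd_m.
set K := quadratic_field (m ^ 2 + 4).
have OP z := ring_of_integersP z m_odd sqf.
have KP := @quadratic_fieldP m.
(* The condition [p %| x + y] describes [Z p + Z (eps - 1)]. *)
pose I : set algC := [set z | exists x y : int,
  (p %| x + y)%Z /\ z = x%:~R + y%:~R * eps m].
have OK_I z : I z -> ring_of_integers K z.
  by move=> [x [y [_ ->]]]; apply/OP; exists x, y.
have Ip : I p%:R by exists p%:Z, 0; rewrite addr0 dvdzz mul0r addr0.
have fI : fractional_ideal K I.
  split.
  - by move=> z /OK_I[].
  - by exists p%:R; rewrite // pnatr_eq0 -lt0n prime_gt0.
  - move=> _ _ [x [y [dvd_xy ->]]] [x' [y' [dvd_xy' ->]]].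
    exists (x + x'), (y + y'); split; first by rewrite addrACA rpredD.
    by rewrite !rmorphD /=; ring.
  - move=> _ _ /OP[a [b ->]] [x [y [dvd_xy ->]]].
    exists (a * x + b * y), (a * y + b * x + m%:Z * b * y); split.
      (* Since [p] divides [m], the sum of coordinates modulo [p] is a ring morphism sending [eps]
         to [1], and [I] is its kernel. *)
      have -> : a * x + b * y + (a * y + b * x + m%:Z * b * y) =
        (a + b) * (x + y) + b * y * m by ring.
      by rewrite rpredD // dvdz_mull // dvdzE.
    by rewrite eps_mul !rmorphD !rmorphM.
  - exists 1; first by apply/OP; exists 1, 0; rewrite mul0r addr0.
    by split; [exact: oner_neq0 | move=> z /OK_I; rewrite mul1r].
have [] := class_number1_principal h1 _ _ _ fI.
- by apply/KP; exists 1, 0; rewrite rmorph1 rmorph0 mul0r addr0.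
- move=> _ _ /KP[a [b ->]] /KP[c [d ->]]; apply/KP.
  exists (a * c + b * d), (a * d + b * c + m%:R * b * d).
  by rewrite eps_mul !rmorphD !rmorphM /= ratr_nat.
- move=> _ _ /KP[a [b ->]] /KP[c [d ->]]; apply/KP.
  by exists (a + c), (b + d); rewrite !rmorphD /=; ring.
move=> alpha _ EI.
have : I alpha.
  rewrite EI; exists 1; last exact: mulr1.
  by apply/OP; exists 1, 0; rewrite mul0r addr0.
case=> x [y [dvd_xy Ealpha]].
(* The generator [alpha] divides every element of [I]; the quotient is read off in coordinates, for
   [p] and then for [eps - 1]. *)
have mulP z1 z2 : I (z1%:~R + z2%:~R * eps m) ->
    exists b c, x * b + y * c = z1 /\ x * c + y * b + m%:Z * y * c = z2.
  rewrite EI => -[_ /OP[b [c ->]]]; rewrite Ealpha eps_mul => E.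
  by exists b, c; apply: (eps_inj (odd_gt0 m_odd) sqf); rewrite -E !rmorphD !rmorphM.
have [|b [c [E1 E2]]] := mulP p 0; first by rewrite mul0r addr0.
have [|b' [c' [E3 _]]] := mulP (-1) 1.
  by exists (-1), 1; rewrite addNr dvdz0.
exists x, y; apply: (nform_prime p_prime _ dvd_xy E1 E2 E3).
by rewrite dvdzE.
Qed.

Local Close Scope ring_scope.
Local Close Scope classical_set_scope.

Theorem theorem1p4 (m : nat) (m_gt0 : 0 < m) (sqf : squarefree (m ^ 2 + 4))
  (h1 : real_quadratic_class_number (m ^ 2 + 4) = 1) : m = 1 \/ prime m.
Proof.
have m_odd : odd m.
  apply: contraT => /negbTE m_even.
  suff /sqf : (2 ^ 2 %| m ^ 2 + 4) by [].
  by rewrite dvdn_add // dvdn_exp2r // dvdn2 m_even.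
have [->|m_neq1] := eqVneq m 1; [by left | right].
have m_gt1 : 1 < m by lia.
have p_prime := pdiv_prime m_gt1.
have [x [y Exy]] := exists_norm_prime m_odd sqf h1 p_prime (pdiv_dvd m).
have [lt_pm|le_mp] := ltnP (pdiv m) m; last first.
  by have /eqP <- : pdiv m == m by rewrite eqn_leq pdiv_leq ?(ltnW m_gt1).
(* If the least prime factor of [m] were below [m], it would be a square. *)
have [|k] := @nform_lt_sqr m x y; first by rewrite Exy ltz_nat.
rewrite Exy => /(congr1 absz); rewrite absz_nat abszX => Ep.
have := p_prime; rewrite Ep => /primeP[k2_gt1].
by move=> /(_ _ (dvdn_exp (isT : 0 < 2) (dvdnn _))); nia.
Qed.
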